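(* Let $\beta,b\in\mathbb{N}^m$ and $A=[A_1|\cdots|A_n]\in\mathbb{N}^{m\times n}$ be such that $\beta\geq b$ and $\beta\geq A_k$ for every $1\leq k\leq n$. Consider the polyhedral cone $$C^*_\beta:=\{\xi\in\mathbb{R}^s:\Theta'\Delta\,\xi\geq0\}$$ and, for $\xi=(\xi_z)\in C^*_\beta$, the exponential-like function $$u\mapsto f_\xi(u):=\sum_{z\in\mathbb{N}^m,\ z\leq\beta}\xi_z\cdot(z^u-1),\qquad u\in\mathbb{N}^m.$$ Then one and only one of the following statements holds: (a) The system $Ax=b$ has an integer solution $x\in\mathbb{N}^n$. (b* ) $f_\xi(b)<0$ for some $\xi\in C^*_\beta$.
   Context: $\mathbb{N}=\{0,1,2,\dots\}$; prime denotes transpose; inequalities between vectors are entrywise; $A_k$ is the $k$-th column of $A$ and $A_{j;k}$ its $j$-th entry. For $w,z\in\mathbb{N}^m$, $w^z:=w_1^{z_1}\cdots w_m^{z_m}$ with $0^0=1$. Set $s:=\prod_{j=1}^m(1+\beta_j)$ and $p:=\sum_{k=1}^n\prod_{j=1}^m(1+\beta_j-A_{j;k})$. Vectors in $\mathbb{R}^s$ are indexed by the $z\in\mathbb{N}^m$ with $z\leq\beta$. The matrix $\Delta\in\mathbb{N}^{s\times s}$ has rows and columns indexed by $z,w\in\mathbb{N}^m$ with $z,w\leq\beta$ and entries $\Delta[z;w]=w^z$. The matrix $\Theta\in\mathbb{Z}^{s\times p}$ has rows indexed by $w\in\mathbb{N}^m$, $w\leq\beta$, and columns indexed by pairs $(k,u)$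 with $1\leq k\leq n$, $u\in\mathbb{N}^m$, $u\leq\beta-A_k$; its column $(k,u)$ has entry $-1$ in row $w=u$, entry $1$ in row $w=u+A_k$, and $0$ elsewhere, i.e. $\Theta[w;(k,u)]=\mathbf{1}_{\{w=u+A_k\}}-\mathbf{1}_{\{w=u\}}$. *)

(* Defs.v *)
From HB Require Import structures.
From mathcomp Require Import all_boot all_order all_algebra.
From mathcomp Require Export reals.

Set Implicit Arguments.
Unset Strict Implicit.
Unset Printing Implicit Defensive.

Import Order.TTheory GRing.Theory Num.Theory.
Local Open Scope ring_scope.

(* For T = nat, (<=%O) is leq. *)
Definition vle (d : Order.disp_t) (T : porderType d) (m : nat)
    (u v : 'cV[T]_m) : bool :=
  [forall i, (u i 0 <= v i 0)%O].

(* Truncated subtraction; only ever applied to A_k <= beta. *)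
Definition vsub (m : nat) (u v : 'cV[nat]_m) : 'cV[nat]_m := map2_mx subn u v.

(* expn satisfies 0 ^ 0 = 1. *)
Definition vpow (m : nat) (w z : 'cV[nat]_m) : nat :=
  (\prod_(j < m) w j 0%R ^ z j 0%R)%N.

Definition box (m : nat) (beta : 'cV[nat]_m) : Type :=
  {z : 'cV[nat]_m | vle z beta}.

HB.instance Definition _ (m : nat) (beta : 'cV[nat]_m) :=
  SubType.on (box beta).
HB.instance Definition _ (m : nat) (beta : 'cV[nat]_m) :=
  [Countable of box beta by <:].

Section BoxFinite.
Variables (m : nat) (beta : 'cV[nat]_m).

Definition box_code (z : box beta) : {dffun forall j, 'I_(beta j 0).+1} :=
  [ffun j => inord (val z j 0)].

Lemma box_decode_subproof (f : {dffun forall j, 'I_(beta j 0).+1}) :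
  vle (\col_j (f j : nat)) beta.
Proof. by apply/forallP => j; rewrite mxE leEnat -ltnS ltn_ord. Qed.

Definition box_decode (f : {dffun forall j, 'I_(beta j 0).+1}) : box beta :=
  exist _ (\col_j (f j : nat)) (box_decode_subproof f).

Lemma box_codeK : cancel box_code box_decode.
Proof.
move=> z; apply: val_inj; apply/colP => j; rewrite /= !mxE ffunE inordK //.
by rewrite ltnS -leEnat; have /forallP := valP z.
Qed.

Lemma box_decodeK : cancel box_decode box_code.
Proof.
by move=> f; apply/ffunP => j; apply: val_inj; rewrite ffunE /= mxE inordK.
Qed.

HB.instance Definition _ : isFinite (box beta) := CanIsFinite box_codeK.

Lemma card_box : #|{: box beta}| = (\prod_(j < m) (1 + beta j 0%R))%N.
Proof.
rewrite (bij_eq_card (Bijective box_codeK box_decodeK)) card_dep_ffun.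
rewrite foldrE big_map big_enum /=.
by apply: eq_bigr => j _; rewrite card_ord.
Qed.

End BoxFinite.

Section Matrices.
Variables (m n : nat) (beta : 'cV[nat]_m) (A : 'M[nat]_(m, n)).

Definition theta_idx : Type := {k : 'I_n & box (vsub beta (col k A))}.
HB.instance Definition _ := Finite.on theta_idx.

Definition sdim : nat := #|{: box beta}|.
Definition pdim : nat := #|{: theta_idx}|.

Lemma sdimE : sdim = (\prod_(j < m) (1 + beta j 0%R))%N.
Proof. exact: card_box. Qed.

Lemma pdimE : (forall k, vle (col k A) beta) ->
  pdim = (\sum_(k < n) \prod_(j < m) (1 + beta j 0%R - A j k))%N.
Proof.
move=> leAb; rewrite /pdim card_tagged sumnE big_map big_enum /=.
apply: eq_bigr => k _; rewrite card_box; apply: eq_bigr => j _.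
by have /forallP/(_ j) := leAb k; rewrite !mxE leEnat => /addnBA ->.
Qed.

(* Coordinate i of a vector of size sdim is the one indexed by zidx i in the
   text; column c of Theta is the one indexed by (k, u) = (aidx c, uidx c). *)
Definition zidx (i : 'I_sdim) : 'cV[nat]_m := val (enum_val i : box beta).
Definition aidx (c : 'I_pdim) : 'I_n := tag (enum_val c : theta_idx).
Definition uidx (c : 'I_pdim) : 'cV[nat]_m := val (tagged (enum_val c : theta_idx)).

Definition Delta : 'M[nat]_sdim := \matrix_(i, j) vpow (zidx j) (zidx i).

Definition Theta : 'M[int]_(sdim, pdim) :=
  \matrix_(i, c) ((zidx i == uidx c + col (aidx c) A)%:Z
                  - (zidx i == uidx c)%:Z).

Definition Cstar (R : realType) (xi : 'cV[R]_sdim) : bool :=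
  vle 0 ((map_mx intr Theta)^T *m (map_mx (fun a : nat => a%:R) Delta *m xi)).

Definition fxi (R : realType) (xi : 'cV[R]_sdim) (u : 'cV[nat]_m) : R :=
  \sum_(i < sdim) xi i 0 * ((vpow (zidx i) u)%:R - 1).

End Matrices.

(* Main.v *)
Require Import Defs.
From mathcomp Require Import all_boot all_order all_algebra reals.
From mathcomp Require Import boolp.

Set Implicit Arguments.
Unset Strict Implicit.
Unset Printing Implicit Defensive.

Import Order.TTheory GRing.Theory Num.Theory.
Local Open Scope ring_scope.

(** Put [g u = sum_z xi_z z^u], so that [Delta xi] is the restriction of [g] to
    the box and [f_xi u = g u - g 0]. Then [xi] lies in the cone iff [g] does not
    decrease along any step [u -> u + A_k] inside the box. If [A x = b], such
    steps lead from [0] to [b], so [f_xi b >= 0]. Otherwise the indicator function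
    of the monoid generated by the [A_k] is nondecreasing along the steps, is [1]
    at [0] and [0] at [b]; since [Delta] is a tensor product of Vandermonde
    matrices, it is of the form [g] for some [xi]. *)

Lemma vleP (m : nat) (u v : 'cV[nat]_m) :
  reflect (forall j, (u j 0%R <= v j 0%R)%N) (vle u v).
Proof. exact: forallP. Qed.

Lemma vle_addl (m : nat) (u v w : 'cV[nat]_m) : vle (u + v) w -> vle u w.
Proof.
by move=> /vleP le_w; apply/vleP => j; apply: leq_trans (le_w j); rewrite mxE leq_addr.
Qed.

Lemma vle_vsub (m : nat) (u v w : 'cV[nat]_m) :
  vle v w -> vle u (vsub w v) = vle (u + v) w.
Proof.
move=> /vleP vw; apply/vleP/vleP => le_j j; have := le_j j;
  by rewrite !mxE leq_subRL // addnC.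
Qed.

Lemma vpow0 (m : nat) (w : 'cV[nat]_m) : vpow w 0 = 1%N.
Proof. by rewrite /vpow big1 // => j _; rewrite mxE expn0. Qed.

(** [L] is the inverse of the Vandermonde matrix on the nodes [0, ..., N], which are distinct in
    [R]. It is the one-dimensional case of inverting [Delta]. *)
Lemma ex_dual_vandermonde (R : realType) (N : nat) :
  {L : nat -> nat -> R | forall u v, (u <= N)%N -> (v <= N)%N ->
     \sum_(w < N.+1) L v w * (w ^ u)%:R = (u == v)%:R}.
Proof.
pose V := Vandermonde N.+1 (\row_(j < N.+1) (j%:R : R)).
have Vunit : V \in unitmx.
  rewrite unitmxE det_Vandermonde unitfE; apply/prodf_neq0 => i _.
  apply/prodf_neq0 => j ltij; rewrite !mxE subr_eq0 eqr_nat.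
  by rewrite neq_ltn ltij orbT.
exists (fun v w => invmx V (inord w) (inord v)) => u v leu lev.
have := congr1 (fun M : 'M_N.+1 => M (inord u) (inord v)) (mulmxV Vunit).
rewrite !mxE -val_eqE /= !inordK // => <-.
by apply: eq_bigr => w _; rewrite !mxE inord_val inordK // natrX mulrC.
Qed.

(** Distributivity, the box being a product of intervals. *)
Lemma big_box_distr (R : comPzSemiRingType) (m : nat) (beta : 'cV[nat]_m)
    (F : 'I_m -> nat -> R) :
  \sum_(z : box beta) \prod_j F j (val z j 0) =
  \prod_j \sum_(k < (beta j 0).+1) F j k.
Proof.
(* Distributivity needs one index type for all factors, so the ranges of different lengths are
   embedded in ['I_K.+1]; [h] identifies the box with the functions bounded by [beta]. *)
pose K := \max_j beta j 0%R.
have leK j : (beta j 0%R <= K)%N by apply: leq_bigmax.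
under [RHS]eq_bigr => j _ do rewrite (big_ord_widen K.+1) ?ltnS //.
rewrite bigA_distr_big_dep.
pose h (z : box beta) : {ffun 'I_m -> 'I_K.+1} := [ffun j => inord (val z j 0)].
pose h' (f : {ffun 'I_m -> 'I_K.+1}) : box beta :=
  box_decode [ffun j => inord (f j)].
have hE z j : h z j = val z j 0 :> nat.
  rewrite ffunE inordK // ltnS (leq_trans _ (leK j)) //.
  by have /vleP := valP z.
rewrite [RHS](reindex h).
  apply: eq_big => [z|z _].
    apply/esym/familyP => j; rewrite unfold_in hE ltnS.
    by have /vleP := valP z.
  by apply: eq_bigr => j _; rewrite hE.
exists h' => [z _|f /familyP fP].
  apply/val_inj/colP => j; rewrite mxE ffunE inordK hE // ltnS.
  by have /vleP := valP z.
apply/ffunP => j; apply/val_inj; rewrite /= hE /= mxE ffunE inordK //.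
exact: fP.
Qed.

Section Certificate.
Variables (R : realType) (m : nat) (beta : 'cV[nat]_m).
Implicit Types (u v : 'cV[nat]_m) (xi : 'cV[R]_(sdim beta)).

Definition expsum xi u : R :=
  \sum_(i < sdim beta) xi i 0 * (vpow (zidx i) u)%:R.

Lemma fxiE xi u : fxi xi u = expsum xi u - expsum xi 0.
Proof.
rewrite /expsum -sumrB; apply: eq_bigr => i _.
by rewrite vpow0 mulrBr.
Qed.

Lemma Delta_mul xi i :
  (map_mx (fun a : nat => a%:R) (Delta beta) *m xi) i 0 = expsum xi (zidx i).
Proof. by rewrite mxE; apply: eq_bigr => j _; rewrite !mxE mulrC. Qed.

Lemma sum_zidx (F : 'cV[nat]_m -> R) :
  \sum_(i < sdim beta) F (zidx i) = \sum_(z : box beta) F (val z).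
Proof. by rewrite [RHS]big_enum_val. Qed.

Lemma sum_zidx_pred1 (F : 'cV[nat]_m -> R) v : vle v beta ->
  \sum_(i < sdim beta) (zidx i == v)%:R * F (zidx i) = F v.
Proof.
move=> hv; pose z : box beta := exist _ v hv.
have zE : zidx (enum_rank z) = v by rewrite /zidx enum_rankK.
rewrite (bigD1 (enum_rank z)) //= zE eqxx mul1r big1 ?addr0 // => i nez.
rewrite -zE; case: eqP => [/val_inj/enum_val_inj eqz|_]; last by rewrite mul0r.
by rewrite eqz eqxx in nez.
Qed.

(** Each column of [Theta] has at most two nonzero entries, so pairing it with [Delta *m xi] leaves
    a difference of two values of [expsum]. As [col k A] lies below [beta], the truncated
    subtraction is exact and the columns are indexed by all the steps inside the box. *)
Lemma CstarP n (A : 'M[nat]_(m, n)) xi : (forall k, vle (col k A) beta) ->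
  Cstar A xi <-> forall k u, vle (u + col k A) beta ->
                   expsum xi u <= expsum xi (u + col k A).
Proof.
move=> hA.
have cE (c : 'I_(pdim beta A)) : vle (uidx c + col (aidx c) A) beta.
  by rewrite -vle_vsub //; apply: (valP (tagged (enum_val c))).
have stepE (c : 'I_(pdim beta A)) :
    ((map_mx intr (Theta beta A))^T *m
       (map_mx (fun a : nat => a%:R) (Delta beta) *m xi)) c 0 =
    expsum xi (uidx c + col (aidx c) A) - expsum xi (uidx c).
  rewrite mxE -(sum_zidx_pred1 _ (cE c)).
  rewrite -[in RHS](sum_zidx_pred1 (expsum xi) (vle_addl (cE c))) -sumrB.
  apply: eq_bigr => i _; rewrite Delta_mul !mxE rmorphB /= -mulrBl.
  by rewrite -!pmulrn.
split=> [/forallP hC k u hu|mono].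
  have hu' : vle u (vsub beta (col k A)) by rewrite vle_vsub.
  pose t : theta_idx beta A :=
    Tagged (fun k => box (vsub beta (col k A))) (exist _ u hu').
  have := hC (enum_rank t).
  by rewrite stepE mxE subr_ge0 /uidx /aidx enum_rankK.
by apply/forallP => c; rewrite stepE mxE subr_ge0 mono.
Qed.

(** Induction on the sum of the entries of [x], taking off one column of [A] at a time; the path
    stays in the box because [A] has nonnegative entries. *)
Lemma Cstar_expsum_ge0 n (A : 'M[nat]_(m, n)) xi (x : 'cV[nat]_n) :
  (forall k, vle (col k A) beta) -> Cstar A xi -> vle (A *m x) beta ->
  expsum xi 0 <= expsum xi (A *m x).
Proof.
move=> hA /(CstarP _ hA) mono.
have [N] := ubnP (\sum_k x k 0%R)%N; elim: N x => // N IH x ltN le_beta.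
have [x0|] := boolP [forall k, x k 0 == 0%N].
  suff -> : x = 0 by rewrite mulmx0.
  by apply/colP => k; rewrite mxE (eqP (forallP x0 k)).
rewrite negb_forall => /existsP[k xk].
pose y : 'cV[nat]_n := \col_i (x i 0%R - (i == k))%N.
have xE : x = y + delta_mx k 0.
  apply/colP => i; rewrite !mxE eqxx andbT natn; apply/esym/subnK.
  by case: eqP => // ->; rewrite lt0n.
have AxE : A *m x = A *m y + col k A by rewrite xE mulmxDr colE.
rewrite AxE in le_beta *; apply: le_trans (mono k _ le_beta).
apply: IH (vle_addl le_beta); rewrite -ltnS (leq_trans _ ltN) // !ltnS.
rewrite [X in (_ < X)%N](bigD1 k) //= [X in (X < _)%N](bigD1 k) //=.
rewrite mxE eqxx subn1 -addSn.
rewrite prednK ?lt0n // leq_add2l; apply: leq_sum => i _.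
by rewrite mxE leq_subr.
Qed.

(** The witness applies to [h] the tensor product of the inverse Vandermonde matrices of the
    coordinates. *)
Lemma expsum_interpolation (h : 'cV[nat]_m -> R) :
  exists xi, forall u, vle u beta -> expsum xi u = h u.
Proof.
pose L j := sval (ex_dual_vandermonde R (beta j 0)).
exists (\col_i \sum_(v : box beta) h (val v) *
          \prod_j L j (val v j 0%R) (zidx i j 0%R)) => u /[dup] hu /vleP leu.
rewrite /expsum; under eq_bigr => i _ do rewrite mxE mulr_suml.
rewrite exchange_big /= -[RHS](sum_zidx_pred1 h hu).
rewrite (sum_zidx (fun v => (v == u)%:R * h v)).
(* It remains to see that the coefficient of [h (val v)] is the Kronecker delta of [val v] and [u];
   it factors over the coordinates. *)
apply: eq_bigr => v _; rewrite [RHS]mulrC.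
under eq_bigr => i _ do rewrite -mulrA.
rewrite -mulr_sumr; congr (_ * _).
under eq_bigr => i _ do rewrite /vpow natr_prod -big_split /=.
rewrite (sum_zidx (fun w => \prod_j
  (L j (val v j 0%R) (w j 0%R) * (w j 0%R ^ u j 0%R)%:R))).
rewrite (big_box_distr beta
  (fun j k => L j (val v j 0%R) k * (k ^ u j 0%R)%:R)).
have lev j : (val v j 0%R <= beta j 0%R)%N by have /vleP := valP v.
under eq_bigr => j _ do rewrite (svalP (ex_dual_vandermonde R _)) //.
have [<-|neq] := eqVneq (val v) u; first by rewrite big1 // => j _; rewrite eqxx.
have /existsP[j nej] : [exists j, u j 0 != val v j 0].
  apply: contraNT neq; rewrite negb_exists => /forallP eqj.
  by apply/eqP/colP => j; apply/esym/eqP; have := eqj j; rewrite negbK.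
by rewrite (bigD1 j) //= (negbTE nej) mul0r.
Qed.

End Certificate.

Theorem mainTheorem5 (R : realType) (m n : nat) (beta b : 'cV[nat]_m)
    (A : 'M[nat]_(m, n))
    (hb : vle b beta) (hA : forall k : 'I_n, vle (col k A) beta) :
  let sol := exists x : 'cV[nat]_n, A *m x = b in
  let cert := exists2 xi : 'cV[R]_(sdim beta), Cstar A xi & fxi xi b < 0 in
  (sol /\ ~ cert) \/ (~ sol /\ cert).
Proof.
move=> sol cert; have [hsol|nsol] := pselect sol.
  left; split=> // -[xi hxi]; case: hsol => x Ax.
  by rewrite fxiE ltNge subr_ge0 -Ax Cstar_expsum_ge0 ?Ax.
right; split=> //.
pose reach (u : 'cV[nat]_m) := exists x : 'cV[nat]_n, A *m x = u.
have [xi xiE] := expsum_interpolation beta (fun u => `[< reach u >]%:R : R).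
exists xi.
  apply/(CstarP _ hA) => k u hu; rewrite !xiE ?(vle_addl hu) // ler_nat.
  (* Only a reachable [u] matters: one more copy of column [k] then reaches [u + col k A]. *)
  case: asboolP => // -[x Ax]; rewrite lt0n eqb0 negbK; apply/asboolP.
  by exists (x + delta_mx k 0); rewrite mulmxDr Ax colE.
rewrite fxiE !xiE //; last by apply/vleP => j; rewrite mxE.
rewrite (asboolF nsol) asboolT ?sub0r ?oppr_lt0 ?ltr01 //.
by exists 0; rewrite mulmx0.
Qed.
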